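(* Let $H$ be a Hopf algebra that acts linearly on an algebra $A$ (so that $A$ is an $H$-module algebra), and let $\sigma:A\to A$ be an automorphism of $A$ which is also an $H$-module homomorphism. Let $\Bbbk t$ be the trivial $H$-module. Then the action of $H$ extends to the Ore extension $A[t;\sigma]$, and $A[t;\sigma]^H=A^H[t;\sigma]$. Further, if the action of $H$ is inner-faithful on $A$ then it is inner-faithful on $A[t;\sigma]$.
   Context: Ground field $\Bbbk=\mathbb{C}$. The trivial $H$-module $\Bbbk t$ satisfies $ht=\epsilon(h)t$, where $\epsilon$ is the counit. $A$ is an $H$-module algebra: $h\cdot(ab)=\sum(h_{(1)}\cdot a)(h_{(2)}\cdot b)$ and $h\cdot1=\epsilon(h)1$. The Ore extension $A[t;\sigma]$ has multiplication determined by $ta=\sigma(a)t$ for $a\in A$. $A^H=\{a\in A:h\cdot a=\epsilon(h)a\ \forall h\in H\}$; $A^H[t;\sigma]$ denotes the Ore extension of $A^H$ by the restriction of $\sigma$, viewed inside $A[t;\sigma]$. An action is inner-faithful if the only Hopf ideal of $H$ annihilating the algebra is $0$. The extended action is the $H$-module algebra structure on $A[t;\sigma]$ restricting to the given actions on $A$ and on $\Bbbk t$. *)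

(* Defs.v *)
From HB Require Import structures.
From mathcomp Require Import all_boot all_order all_algebra.
From mathcomp Require Import sesquilinear.
From mathcomp Require Import boolp classical_sets reals.
From mathcomp Require Import complex.

Set Implicit Arguments.
Unset Strict Implicit.
Unset Printing Implicit Defensive.

Import Order.TTheory GRing.Theory Num.Theory.
Local Open Scope quotient_scope.
Local Open Scope classical_set_scope.
Local Open Scope ring_scope.

Section Tensor.
Variables (k : fieldType) (U V : lmodType k).

(* U (x) V is the quotient of the formal finite sums of pairs (u, v),
   represented by lists, by the smallest congruence making the class of (u, v)
   bilinear.  Scalars and signs are absorbed into the left factor. *)
Inductive tensor_rel : seq (U * V) -> seq (U * V) -> Prop :=
| TensorRefl s : tensor_rel s s
| TensorSym s t : tensor_rel s t -> tensor_rel t s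
| TensorTrans s t r : tensor_rel s t -> tensor_rel t r -> tensor_rel s r
| TensorPerm s t : perm_eq s t -> tensor_rel s t
| TensorCat s t r : tensor_rel s t -> tensor_rel (s ++ r) (t ++ r)
| TensorZero v : tensor_rel [:: (0, v)] [::]
| TensorAddl u u' v : tensor_rel [:: (u + u', v)] [:: (u, v); (u', v)]
| TensorAddr u v v' : tensor_rel [:: (u, v + v')] [:: (u, v); (u, v')]
| TensorScale a u v : tensor_rel [:: (a *: u, v)] [:: (u, a *: v)].

Definition tensor_eqv (s t : seq (U * V)) : bool := `[< tensor_rel s t >].

Lemma tensor_eqv_refl : reflexive tensor_eqv.
Proof. by move=> s; apply/asboolP/TensorRefl. Qed.

Lemma tensor_eqv_sym : symmetric tensor_eqv.
Proof. by move=> s t; apply/asboolP/asboolP => /TensorSym. Qed.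

Lemma tensor_eqv_trans : transitive tensor_eqv.
Proof.
by move=> t s r /asboolP st /asboolP tr; apply/asboolP/(TensorTrans st).
Qed.

Canonical tensor_equiv :=
  EquivRel tensor_eqv tensor_eqv_refl tensor_eqv_sym tensor_eqv_trans.

Definition tensor : Type := {eq_quot tensor_equiv}.

HB.instance Definition _ := Choice.on tensor.
HB.instance Definition _ := EqQuotient.on tensor.

Definition tens_sum (s : seq (U * V)) : tensor := \pi_tensor s.

Lemma tens_sumP s t : reflect (tensor_rel s t) (tens_sum s == tens_sum t).
Proof. by rewrite /tens_sum piE /=; exact: asboolP. Qed.

Lemma tens_sum_repr x : tens_sum (repr x) = x.
Proof. exact: reprK. Qed.

Lemma tens_sum_eq s t : tensor_rel s t -> tens_sum s = tens_sum t.
Proof. by move/tens_sumP/eqP. Qed.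

Lemma tensor_rel_repr s : tensor_rel (repr (tens_sum s)) s.
Proof. by apply/tens_sumP; rewrite tens_sum_repr. Qed.

Lemma tensor_rel_cat s s' t t' :
  tensor_rel s s' -> tensor_rel t t' -> tensor_rel (s ++ t) (s' ++ t').
Proof.
move=> ss' tt'; apply: (TensorTrans (TensorCat t ss')).
apply: (TensorTrans (TensorPerm (permEl (perm_catC _ _)))).
apply: (TensorTrans (TensorCat s' tt')).
exact/TensorPerm/permEl/perm_catC.
Qed.

Definition zscale (a : k) (s : seq (U * V)) : seq (U * V) :=
  [seq (a *: p.1, p.2) | p <- s].

Lemma tensor_rel_scale a s t :
  tensor_rel s t -> tensor_rel (zscale a s) (zscale a t).
Proof.
elim=> {s t} [s|s t _|s t r _ IH1 _|s t st|s t r _ IH|v|u u' v|u v v'|b u v] /=.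
- exact: TensorRefl.
- exact: TensorSym.
- exact: TensorTrans.
- exact/TensorPerm/perm_map.
- by rewrite /zscale !map_cat; exact: TensorCat.
- by rewrite /zscale /= scaler0; exact: TensorZero.
- by rewrite /zscale /= scalerDr; exact: TensorAddl.
- exact: TensorAddr.
- by rewrite /zscale /= scalerA mulrC -scalerA; exact: TensorScale.
Qed.

Definition tensor_zero : tensor := tens_sum [::].
Definition tensor_add (x y : tensor) : tensor := tens_sum (repr x ++ repr y).
Definition tensor_scale (a : k) (x : tensor) : tensor :=
  tens_sum (zscale a (repr x)).
Definition tensor_opp (x : tensor) : tensor := tensor_scale (- 1) x.

Lemma tensor_addE s t :
  tensor_add (tens_sum s) (tens_sum t) = tens_sum (s ++ t).
Proof. exact/tens_sum_eq/tensor_rel_cat/tensor_rel_repr/tensor_rel_repr. Qed.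

Lemma tensor_scaleE a s : tensor_scale a (tens_sum s) = tens_sum (zscale a s).
Proof. exact/tens_sum_eq/tensor_rel_scale/tensor_rel_repr. Qed.

Lemma tensor_ind_sum (P : tensor -> Prop) :
  (forall s, P (tens_sum s)) -> forall x, P x.
Proof. by move=> Ps x; rewrite -[x]tens_sum_repr. Qed.

Lemma tensor_addA : associative tensor_add.
Proof.
elim/tensor_ind_sum=> s; elim/tensor_ind_sum=> t; elim/tensor_ind_sum=> r.
by rewrite !tensor_addE catA.
Qed.

Lemma tensor_addC : commutative tensor_add.
Proof.
elim/tensor_ind_sum=> s; elim/tensor_ind_sum=> t; rewrite !tensor_addE.
exact/tens_sum_eq/TensorPerm/permEl/perm_catC.
Qed.

Lemma tensor_add0 : left_id tensor_zero tensor_add.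
Proof. by elim/tensor_ind_sum=> s; rewrite tensor_addE. Qed.

Lemma tensor_scaleDl x : {morph tensor_scale^~ x : a b / a + b >-> tensor_add a b}.
Proof.
elim/tensor_ind_sum: x => s a b; rewrite !tensor_scaleE tensor_addE.
apply: tens_sum_eq; elim: s => [|[u v] s IH] /=; first exact: TensorRefl.
rewrite scalerDl -cat1s.
apply: (TensorTrans (tensor_rel_cat (TensorAddl _ _ _) IH)).
apply: TensorPerm; rewrite /= perm_cons.
by rewrite -cat1s perm_sym -cat1s perm_catCA.
Qed.

Lemma tensor_scale0 x : tensor_scale 0 x = tensor_zero.
Proof.
elim/tensor_ind_sum: x => s; rewrite tensor_scaleE; apply: tens_sum_eq.
elim: s => [|[u v] s IH] /=; first exact: TensorRefl.
by rewrite scale0r -cat1s -[[::]]cat0s; exact: tensor_rel_cat (TensorZero _) IH.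
Qed.

Lemma tensor_scale1 : left_id 1 tensor_scale.
Proof.
elim/tensor_ind_sum=> s; rewrite tensor_scaleE; congr tens_sum.
by rewrite -[RHS]map_id; apply: eq_map => -[u v] /=; rewrite scale1r.
Qed.

Lemma tensor_addN : left_inverse tensor_zero tensor_opp tensor_add.
Proof.
move=> x; rewrite -{2}[x]tensor_scale1 /tensor_opp -tensor_scaleDl addNr.
exact: tensor_scale0.
Qed.

HB.instance Definition _ := GRing.isZmodule.Build tensor
  tensor_addA tensor_addC tensor_add0 tensor_addN.

Lemma tensor_scaleA a b x :
  tensor_scale a (tensor_scale b x) = tensor_scale (a * b) x.
Proof.
elim/tensor_ind_sum: x => s; rewrite !tensor_scaleE; congr tens_sum.
by rewrite /zscale -map_comp; apply: eq_map => p /=; rewrite scalerA.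
Qed.

Lemma tensor_scaleDr : right_distributive tensor_scale +%R.
Proof.
move=> a; elim/tensor_ind_sum=> s; elim/tensor_ind_sum=> t.
by rewrite /GRing.add /= tensor_addE !tensor_scaleE tensor_addE /zscale map_cat.
Qed.

HB.instance Definition _ := GRing.Zmodule_isLmodule.Build k tensor
  tensor_scaleA tensor_scale1 tensor_scaleDr tensor_scaleDl.

Lemma tens_sumD s t : tens_sum s + tens_sum t = tens_sum (s ++ t).
Proof. exact: tensor_addE. Qed.

Lemma tens_sumZ a s : a *: tens_sum s = tens_sum (zscale a s).
Proof. exact: tensor_scaleE. Qed.

Definition tens (u : U) (v : V) : tensor := tens_sum [:: (u, v)].

Lemma tens_sumE s : tens_sum s = \sum_(p <- s) tens p.1 p.2.
Proof.
elim: s => [|[u v] s IH]; first by rewrite big_nil.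
by rewrite big_cons -IH tens_sumD.
Qed.

Lemma tens_bilinear : bilinear_for *:%R *:%R tens.
Proof.
have tensZr a u v : tens u (a *: v) = a *: tens u v.
  by rewrite /tens tens_sumZ; exact/tens_sum_eq/TensorSym/TensorScale.
split=> [v|u] a x y /=.
  by rewrite /tens tens_sumZ tens_sumD; exact/tens_sum_eq/TensorAddl.
by rewrite -tensZr /tens tens_sumD; exact/tens_sum_eq/TensorAddr.
Qed.

HB.instance Definition _ :=
  bilinear_isBilinear.Build k U V tensor *:%R *:%R tens tens_bilinear.

(* The linear map on U (x) V induced by a map f, meaningful when f is
   bilinear. *)
Definition tlift (W : lmodType k) (f : U -> V -> W) (x : tensor) : W :=
  \sum_(p <- repr x) f p.1 p.2.

Section TliftTheory.
Variables (W : lmodType k) (f : U -> V -> W).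
Hypothesis f_bilin : bilinear_for *:%R *:%R f.

Let fDl u u' v : f (u + u') v = f u v + f u' v.
Proof. by have := f_bilin.1 v 1 u u'; rewrite /= !scale1r. Qed.
Let fDr u v v' : f u (v + v') = f u v + f u v'.
Proof. by have := f_bilin.2 u 1 v v'; rewrite /= !scale1r. Qed.
Let f0l v : f 0 v = 0.
Proof. by apply: (addIr (f 0 v)); rewrite -fDl !add0r. Qed.
Let f0r u : f u 0 = 0.
Proof. by apply: (addIr (f u 0)); rewrite -fDr !add0r. Qed.
Let fZl a u v : f (a *: u) v = a *: f u v.
Proof. by have := f_bilin.1 v a u 0; rewrite /= !addr0 f0l addr0. Qed.
Let fZr a u v : f u (a *: v) = a *: f u v.
Proof. by have := f_bilin.2 u a v 0; rewrite /= !addr0 f0r addr0. Qed.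

Lemma tensor_rel_lift s t : tensor_rel s t ->
  \sum_(p <- s) f p.1 p.2 = \sum_(p <- t) f p.1 p.2.
Proof.
elim=> {s t} [s|s t _ ->|s t r _ -> _ ->|s t st|s t r _ IH|v|u u' v|u v v'|b u v] //.
- exact: perm_big.
- by rewrite !big_cat IH.
- by rewrite big_seq1 big_nil f0l.
- by rewrite big_seq1 !big_cons big_nil addr0 fDl.
- by rewrite big_seq1 !big_cons big_nil addr0 fDr.
- by rewrite !big_seq1 fZl fZr.
Qed.

Lemma tlift_sum s : tlift f (tens_sum s) = \sum_(p <- s) f p.1 p.2.
Proof. exact/tensor_rel_lift/tensor_rel_repr. Qed.

Lemma tlift_tens u v : tlift f (tens u v) = f u v.
Proof. by rewrite tlift_sum big_seq1. Qed.

Lemma tlift_linear : linear (tlift f).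
Proof.
move=> a; elim/tensor_ind_sum=> s; elim/tensor_ind_sum=> t.
rewrite tens_sumZ tens_sumD !tlift_sum.
rewrite big_cat big_map /= [a *: _]scaler_sumr; congr (_ + _).
by apply: eq_bigr => p _; rewrite fZl.
Qed.

End TliftTheory.

Lemma tensor_linear_ext (W : lmodType k) (f g : {linear tensor -> W}) :
  (forall u v, f (tens u v) = g (tens u v)) -> f =1 g.
Proof.
move=> fg; elim/tensor_ind_sum=> s; rewrite tens_sumE !linear_sum.
by apply: eq_bigr.
Qed.

End Tensor.

Definition tmap (k : fieldType) (U V U' V' : lmodType k)
    (f : U -> U') (g : V -> V') : tensor U V -> tensor U' V' :=
  tlift (fun u v => tens (f u) (g v)).

Definition tassoc (k : fieldType) (U V W : lmodType k) :
    tensor (tensor U V) W -> tensor U (tensor V W) :=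
  tlift (fun x w => tlift (fun u v => tens u (tens v w)) x).

(* (a (x) b) (c (x) d) = ac (x) bd *)
Definition tmul (k : fieldType) (A B : algType k) (x y : tensor A B) :
    tensor A B :=
  tlift (fun a b => tlift (fun c d => tens (a * c) (b * d)) y) x.

HB.mixin Record Algebra_isHopf (k : fieldType) H of GRing.Algebra k H := {
  comul : H -> tensor H H;
  counit : H -> k;
  antipode : H -> H;
  comul_linear : linear comul;
  counit_linear : scalar counit;
  antipode_linear : linear antipode;
  comulA : forall h,
    tassoc (tmap comul id (comul h)) = tmap id comul (comul h);
  counitl : forall h, tlift (fun x y => counit x *: y) (comul h) = h;
  counitr : forall h, tlift (fun x y => counit y *: x) (comul h) = h;
  comul1 : comul 1 = tens 1 1;
  comulM : forall g h, comul (g * h) = tmul (comul g) (comul h);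
  counit1 : counit 1 = 1;
  counitM : forall g h, counit (g * h) = counit g * counit h;
  antipodel : forall h,
    tlift (fun x y => antipode x * y) (comul h) = counit h *: 1;
  antipoder : forall h,
    tlift (fun x y => x * antipode y) (comul h) = counit h *: 1
}.

#[short(type="hopfAlgType")]
HB.structure Definition HopfAlgebra (k : fieldType) :=
  { H of GRing.Algebra k H & Algebra_isHopf k H }.

HB.instance Definition _ (k : fieldType) (H : hopfAlgType k) :=
  GRing.isLinear.Build k H (tensor H H) *:%R (@comul k H) (@comul_linear k H).
HB.instance Definition _ (k : fieldType) (H : hopfAlgType k) :=
  GRing.isLinear.Build k H k *%R (@counit k H) (@counit_linear k H).
HB.instance Definition _ (k : fieldType) (H : hopfAlgType k) :=
  GRing.isLinear.Build k H H *:%R (@antipode k H) (@antipode_linear k H).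

Section HopfIdeal.
Variables (k : fieldType) (H : hopfAlgType k).

(* The image of P (x) Q in U (x) V when P and Q are subspaces. *)
Definition tensor_span (U V : lmodType k) (P : set U) (Q : set V) :
    set (tensor U V) :=
  [set x | exists s : seq (U * V),
     (forall p, p \in s -> P p.1 /\ Q p.2) /\
     x = \sum_(p <- s) tens p.1 p.2].

Record hopf_ideal (I : set H) : Prop := HopfIdeal {
  hopf_ideal0 : I 0;
  hopf_idealD : forall x y, I x -> I y -> I (x + y);
  hopf_idealMl : forall h x, I x -> I (h * x);
  hopf_idealMr : forall x h, I x -> I (x * h);
  hopf_ideal_comul : forall x, I x ->
    exists y z, [/\ tensor_span I setT y, tensor_span setT I z &
                    comul x = y + z];
  hopf_ideal_counit : forall x, I x -> counit x = 0;
  hopf_ideal_antipode : forall x, I x -> I (antipode x)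
}.

End HopfIdeal.

Record module_algebra (k : fieldType) (H : hopfAlgType k) (A : algType k) :=
  ModuleAlgebra {
  act :> H -> A -> A;
  act_bilinear : bilinear_for *:%R *:%R act;
  act1 : forall a, act 1 a = a;
  actM : forall g h a, act (g * h) a = act g (act h a);
  act_mul : forall h a b,
    act h (a * b) = tlift (fun x y => act x a * act y b) (comul h);
  act_one : forall h, act h 1 = counit h *: 1
}.

Section ModuleAlgebra.
Variables (k : fieldType) (H : hopfAlgType k) (A : algType k).
Variable rho : module_algebra H A.

HB.instance Definition _ :=
  bilinear_isBilinear.Build k H A A *:%R *:%R (act rho) (act_bilinear rho).

Definition inner_faithful : Prop :=
  forall I : set H, hopf_ideal I ->
    (forall h, I h -> forall a, rho h a = 0) -> I = [set 0].

Definition invariants : {pred A} :=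
  fun a => `[< forall h, rho h a = counit h *: a >].

Lemma invariantsP a :
  reflect (forall h, rho h a = counit h *: a) (a \in invariants).
Proof. exact: asboolP. Qed.

Lemma act_mul_bilinear a b :
  bilinear_for *:%R *:%R (fun x y => rho x a * rho y b).
Proof.
split=> [y|x] c u v /=.
  by rewrite (linearPl (act rho)) mulrDl -scalerAl.
by rewrite (linearPl (act rho)) mulrDr -scalerAr.
Qed.

Lemma invariants_closed : GRing.subsemialg_closed invariants.
Proof.
apply: GRing.subalg_closed_semi; split.
- by apply/invariantsP=> h; rewrite act_one.
- move=> c a b /invariantsP ia /invariantsP ib; apply/invariantsP=> h.
  by rewrite (linearPr (act rho)) /= ia ib scalerDr !scalerA mulrC.
- move=> a b /invariantsP ia /invariantsP ib; apply/invariantsP=> h.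
  rewrite act_mul -[in RHS](counitl h) /tlift linear_sum scaler_suml.
  apply: eq_bigr => -[x y] _ /=; rewrite ia ib linearZ /=.
  by rewrite -scalerAl -scalerAr scalerA.
Qed.

Record inv_alg : Type := InvAlg {
  inv_val : A;
  inv_valP : inv_val \in invariants
}.

HB.instance Definition _ := [isSub for inv_val].
HB.instance Definition _ := [Choice of inv_alg by <:].
HB.instance Definition _ :=
  GRing.SubChoice_isSubAlgebra.Build k A invariants inv_alg invariants_closed.

Variable sigma : {lrmorphism A -> A}.
Hypothesis sigmaH : forall h a, sigma (rho h a) = rho h (sigma a).

Lemma inv_restr_subproof (a : inv_alg) : sigma (inv_val a) \in invariants.
Proof.
apply/invariantsP=> h.
by rewrite -sigmaH (invariantsP _ (inv_valP a)) linearZ.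
Qed.

Definition inv_restr (a : inv_alg) : inv_alg := InvAlg (inv_restr_subproof a).

Lemma inv_restr_is_linear : linear inv_restr.
Proof. by move=> c a b; apply: val_inj; rewrite /= linearP. Qed.

Lemma inv_restr_is_monoid_morphism : monoid_morphism inv_restr.
Proof.
by split=> [|a b]; apply: val_inj; rewrite /= ?rmorph1 ?rmorphM.
Qed.

HB.instance Definition _ :=
  GRing.isLinear.Build k inv_alg inv_alg *:%R inv_restr inv_restr_is_linear.
HB.instance Definition _ :=
  GRing.isMonoidMorphism.Build inv_alg inv_alg inv_restr
    inv_restr_is_monoid_morphism.

End ModuleAlgebra.

(* A[t; sigma]: the polynomial with coefficients p`_i stands for
   \sum_i p`_i t^i, coefficients on the left. *)
Definition ore (k : fieldType) (A : algType k) (sigma : {lrmorphism A -> A}) :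
  Type := {poly A}.
Arguments ore {k A} sigma.

Section Ore.
Variables (k : fieldType) (A : algType k) (sigma : {lrmorphism A -> A}).
Local Notation ore := (ore sigma).

HB.instance Definition _ := GRing.Zmodule.copy ore {poly A}.

Definition ore_scale (c : k) (p : ore) : ore := c%:A *: (p : {poly A}).

Lemma coef_ore_scale c (p : ore) i : (ore_scale c p)`_i = c *: p`_i.
Proof. by rewrite coefZ mulr_algl. Qed.

Lemma ore_scaleA a b p : ore_scale a (ore_scale b p) = ore_scale (a * b) p.
Proof. by apply/polyP=> i; rewrite !coef_ore_scale scalerA. Qed.

Lemma ore_scale1 : left_id 1 ore_scale.
Proof. by move=> p; apply/polyP=> i; rewrite coef_ore_scale scale1r. Qed.

Lemma ore_scaleDr : right_distributive ore_scale +%R.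
Proof.
by move=> a p q; apply/polyP=> i; rewrite coefD !coef_ore_scale coefD scalerDr.
Qed.

Lemma ore_scaleDl p : {morph ore_scale^~ p : a b / a + b}.
Proof.
by move=> a b; apply/polyP=> i; rewrite coefD !coef_ore_scale scalerDl.
Qed.

HB.instance Definition _ := GRing.Zmodule_isLmodule.Build k ore
  ore_scaleA ore_scale1 ore_scaleDr ore_scaleDl.

(* (a t^i) (b t^j) = a sigma^i(b) t^(i + j) *)
Definition ore_mul (p q : ore) : ore :=
  \poly_(n < size p + size q)
    \sum_(i < n.+1) p`_i * iter i sigma q`_(n - i).

Lemma iter0_sigma i : iter i sigma 0 = 0.
Proof. by elim: i => //= i ->; rewrite raddf0. Qed.

Lemma iter1_sigma i : iter i sigma 1 = 1.
Proof. by elim: i => //= i ->; rewrite rmorph1. Qed.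

Lemma iterD_sigma i : {morph iter i sigma : a b / a + b}.
Proof. by elim: i => //= i IH a b /=; rewrite IH raddfD. Qed.

Lemma iterM_sigma i : {morph iter i sigma : a b / a * b}.
Proof. by elim: i => //= i IH a b /=; rewrite IH rmorphM. Qed.

Lemma iterZ_sigma i c : {morph iter i sigma : a / c *: a}.
Proof. by elim: i => //= i IH a /=; rewrite IH linearZ. Qed.

Lemma coef_ore_mul p q n :
  (ore_mul p q)`_n = \sum_(i < n.+1) p`_i * iter i sigma q`_(n - i).
Proof.
rewrite coef_poly; case: ltnP => // le_pq_n.
rewrite big1 // => i _; have [le_p_i|lt_i_p] := leqP (size p) i.
  by rewrite [p`_i]nth_default ?mul0r.
rewrite [q`__]nth_default ?iter0_sigma ?mulr0 // leq_subRL; last first.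
  by rewrite -ltnS ltn_ord.
by rewrite (leq_trans _ le_pq_n) // leq_add2r ltnW.
Qed.

Lemma ore_mulA : associative ore_mul.
Proof.
move=> p q r; apply/polyP=> n; rewrite !coef_ore_mul.
pose c i m := p`_i * iter i sigma q`_(m - i) * iter m sigma r`_(n - m).
transitivity (\sum_(i < n.+1) \sum_(m < n.+1 | (i <= m)%N) c i m).
  apply: eq_bigr => i _; rewrite coef_ore_mul.
  rewrite (big_morph _ (iterD_sigma i) (iter0_sigma i)) mulr_sumr.
  rewrite -(big_geq_mkord i n.+1 predT (c i)) -[nat_of_ord i in RHS]add0n.
  rewrite big_addn subSn ?leq_ord // big_mkord; apply: eq_bigr => j _.
  by rewrite add0n /c addnK [(j + i)%N]addnC subnDA iterD iterM_sigma mulrA.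
rewrite (exchange_big_dep predT) //=; apply: eq_bigr => m _.
rewrite coef_ore_mul mulr_suml (big_ord_narrow_leq (leq_ord m)).
by apply: eq_bigr.
Qed.

Lemma ore_mul1l : left_id (1%:P : ore) ore_mul.
Proof.
move=> p; apply/polyP=> n; rewrite coef_ore_mul big_ord_recl subn0 coefC /=.
by rewrite mul1r big1 ?addr0 // => i _; rewrite coefC /= mul0r.
Qed.

Lemma ore_mul1r : right_id (1%:P : ore) ore_mul.
Proof.
move=> p; apply/polyP=> n; rewrite coef_ore_mul big_ord_recr /= subnn coefC.
rewrite iter1_sigma mulr1 big1 ?add0r // => i _.
by rewrite coefC subn_eq0 leqNgt ltn_ord /= iter0_sigma mulr0.
Qed.

Lemma ore_mulDl : left_distributive ore_mul +%R.
Proof.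
move=> p q r; apply/polyP=> n; rewrite coefD !coef_ore_mul -big_split.
by apply: eq_bigr => i _; rewrite coefD mulrDl.
Qed.

Lemma ore_mulDr : right_distributive ore_mul +%R.
Proof.
move=> p q r; apply/polyP=> n; rewrite coefD !coef_ore_mul -big_split.
by apply: eq_bigr => i _; rewrite coefD iterD_sigma mulrDr.
Qed.

Lemma ore_one_neq0 : (1%:P : ore) != 0.
Proof. exact: (oner_neq0 {poly A}). Qed.

HB.instance Definition _ := GRing.Zmodule_isNzRing.Build ore
  ore_mulA ore_mul1l ore_mul1r ore_mulDl ore_mulDr ore_one_neq0.

Lemma ore_scaleAl (c : k) (p q : ore) : c *: (p * q) = (c *: p) * q.
Proof.
apply/polyP=> n; rewrite coef_ore_scale !coef_ore_mul scaler_sumr.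
by apply: eq_bigr => i _; rewrite coef_ore_scale scalerAl.
Qed.

HB.instance Definition _ := GRing.Lmodule_isLalgebra.Build k ore ore_scaleAl.

Lemma ore_scaleAr (c : k) (p q : ore) : c *: (p * q) = p * (c *: q).
Proof.
apply/polyP=> n; rewrite coef_ore_scale !coef_ore_mul scaler_sumr.
by apply: eq_bigr => i _; rewrite coef_ore_scale iterZ_sigma scalerAr.
Qed.

HB.instance Definition _ := GRing.Lalgebra_isAlgebra.Build k ore ore_scaleAr.

Definition oreC (a : A) : ore := a%:P.
Definition oreX : ore := 'X.

Lemma coef_oreCM a (p : ore) n : (oreC a * p)`_n = a * p`_n.
Proof.
rewrite coef_ore_mul big_ord_recl subn0 coefC /=.
by rewrite big1 ?addr0 // => i _; rewrite coefC /= mul0r.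
Qed.

Lemma coef_oreXM (p : ore) n :
  (oreX * p)`_n = if n == 0%N then 0 else sigma p`_n.-1.
Proof.
rewrite coef_ore_mul big_ord_recl coefX mul0r add0r.
case: n => [|n]; first by rewrite big_ord0.
rewrite big_ord_recl coefX mul1r /= subn1 big1 ?addr0 // => i _.
by rewrite coefX mul0r.
Qed.

Lemma oreXC a : oreX * oreC a = oreC (sigma a) * oreX.
Proof.
apply/polyP=> n; rewrite coef_oreXM coef_oreCM coefC coefX.
by case: n => [|[|n]]; rewrite ?mulr0 ?mulr1 ?raddf0.
Qed.

Lemma oreE (p : ore) : p = \sum_(i < size p) oreC p`_i * oreX ^+ i.
Proof.
have oreXnE n : oreX ^+ n = 'X^n :> {poly A}.
  elim: n => // n IH; rewrite exprS; apply/polyP=> i.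
  rewrite coef_oreXM IH !coefXn; case: i => //= i.
  by rewrite eqSS; case: eqP; rewrite ?rmorph1 ?raddf0.
rewrite -[LHS]coefK poly_def; apply: eq_bigr => i _.
apply/polyP=> n; rewrite coefZ coef_oreCM oreXnE.
by [].
Qed.

End Ore.

Arguments oreC {k A} sigma a.
Arguments oreX {k A} sigma.

Section OreInclusion.
Variables (k : fieldType) (H : hopfAlgType k) (A : algType k).
Variables (rho : module_algebra H A) (sigma : {lrmorphism A -> A}).
Hypothesis sigmaH : forall h a, sigma (rho h a) = rho h (sigma a).

Let tau : {lrmorphism inv_alg rho -> inv_alg rho} := inv_restr sigmaH.

Definition ore_incl (q : ore tau) : ore sigma := 
  map_poly (val : inv_alg rho -> A) q.

Lemma coef_ore_incl q i : (ore_incl q)`_i = val q`_i.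
Proof. by rewrite coef_map_id0. Qed.

Lemma ore_incl_inj : injective ore_incl.
Proof.
move=> p q pq; apply/polyP=> i; apply: val_inj.
by rewrite /= -!coef_ore_incl pq.
Qed.

Lemma ore_incl_is_linear : linear ore_incl.
Proof.
move=> c p q; apply/polyP=> i.
by rewrite coefD coef_ore_scale !coef_ore_incl coefD coef_ore_scale.
Qed.

Lemma ore_incl_is_monoid_morphism : monoid_morphism ore_incl.
Proof.
split=> [|p q]; apply/polyP=> n.
  by rewrite coef_ore_incl !coefC; case: n.
rewrite coef_ore_incl !coef_ore_mul raddf_sum; apply: eq_bigr => i _.
rewrite [LHS]rmorphM !coef_ore_incl /=; congr (_ * _).
by move: q`_(n - i) => b; elim: (nat_of_ord i) => //= j ->.
Qed.

HB.instance Definition _ := GRing.isLinear.Build k (ore tau) (ore sigma) *:%R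
  ore_incl ore_incl_is_linear.
HB.instance Definition _ :=
  GRing.isMonoidMorphism.Build (ore tau) (ore sigma) ore_incl
    ore_incl_is_monoid_morphism.

End OreInclusion.

Definition extends_to_ore (k : fieldType) (H : hopfAlgType k) (A : algType k)
    (rho : module_algebra H A) (sigma : {lrmorphism A -> A})
    (rho' : module_algebra H (ore sigma)) : Prop :=
  (forall h a, rho' h (oreC sigma a) = oreC sigma (rho h a)) /\
  (forall h, rho' h (oreX sigma) = counit h *: oreX sigma).

(* Main.v *)
Require Import Defs.
From mathcomp Require Import all_boot all_order all_algebra.
From mathcomp Require Import boolp classical_sets reals complex.

(** The action of [H] on [ore sigma] is coefficientwise, and this describes
    every extension of the given action.

    Coefficientwise action does define a module algebra: the coefficients of
    [p * q] are sums of products [p`_i * sigma^i(q`_j)], and since [sigma^i]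
    commutes with [H] the coproduct formula for [A] distributes over them
    ([ore_act_mul]).

    Conversely, in any extension [t] is invariant, hence so are its powers, and
    acting on [b * c] with [c] invariant only affects [b], by the counit axiom
    ([act_mul_invr]).  So [h] sends [a t^i] to [(h a) t^i], and the extension is
    coefficientwise ([act_extE]).

    Both remaining claims are read off the coefficients: a polynomial is
    invariant exactly when its coefficients are, and a Hopf ideal that kills
    [ore sigma] kills the constant polynomials, hence [A]. *)

Set Implicit Arguments.
Unset Strict Implicit.
Unset Printing Implicit Defensive.

Import GRing.Theory.
Local Open Scope classical_set_scope.
Local Open Scope ring_scope.

Section Invariants.
Variables (k : fieldType) (H : hopfAlgType k) (A : algType k).
Variable rho : module_algebra H A.

(** If [h c = counit h c] for all [h], then
    [h (b c) = \sum (counit h_(2) h_(1) b) c], and the counit axiom collapses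
    the coproduct. *)
Lemma act_mul_invr h b c :
  c \in invariants rho -> rho h (b * c) = rho h b * c.
Proof.
move=> /invariantsP ic; rewrite act_mul -[h in RHS](counitr h) /tlift.
rewrite linear_sumlz mulr_suml; apply: eq_bigr => -[x y] _ /=.
by rewrite ic (linearZl_LR (act rho)) /= -scalerAr -scalerAl.
Qed.

Lemma invariantsX c n : c \in invariants rho -> c ^+ n \in invariants rho.
Proof.
move=> ic; elim: n => [|n IH].
  by apply/invariantsP=> h; rewrite expr0 act_one.
apply/invariantsP=> h; rewrite exprSr act_mul_invr //.
by rewrite (invariantsP _ _ IH) scalerAl.
Qed.

End Invariants.

Section OreExtension.
Variables (k : fieldType) (H : hopfAlgType k) (A : algType k).
Variables (rho : module_algebra H A) (sigma : {lrmorphism A -> A}).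
Hypothesis sigmaH : forall h a, sigma (rho h a) = rho h (sigma a).

Definition ore_act (h : H) (p : ore sigma) : ore sigma := map_poly (rho h) p.

Lemma coef_ore_act h p i : (ore_act h p)`_i = rho h p`_i.
Proof. by rewrite coef_map_id0 // (linear0r (act rho)). Qed.

Lemma ore_act_bilinear : bilinear_for *:%R *:%R ore_act.
Proof.
split=> [p|h] c x y /=; apply/polyP=> i.
  by rewrite coefD coef_ore_scale !coef_ore_act (linearPl (act rho)).
rewrite coefD coef_ore_scale !coef_ore_act coefD coef_ore_scale.
by rewrite (linearPr (act rho)).
Qed.

Lemma ore_act1 p : ore_act 1 p = p.
Proof. by apply/polyP=> i; rewrite coef_ore_act act1. Qed.

Lemma ore_actM g h p : ore_act (g * h) p = ore_act g (ore_act h p).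
Proof. by apply/polyP=> i; rewrite !coef_ore_act actM. Qed.

Lemma act_iter_sigma h i a : iter i sigma (rho h a) = rho h (iter i sigma a).
Proof. by elim: i => //= i ->. Qed.

Lemma ore_act_mul h p q :
  ore_act h (p * q) = tlift (fun x y => ore_act x p * ore_act y q) (comul h).
Proof.
apply/polyP=> n; rewrite coef_ore_act coef_ore_mul /tlift coef_sum.
rewrite linear_sumr.
under [RHS]eq_bigr do rewrite coef_ore_mul.
rewrite exchange_big; apply: eq_bigr => i _ /=.
rewrite act_mul; apply: eq_bigr => -[x y] _ /=.
by rewrite !coef_ore_act act_iter_sigma.
Qed.

Lemma ore_act_oreC h a : ore_act h (oreC sigma a) = oreC sigma (rho h a).
Proof.
apply/polyP=> i; rewrite coef_ore_act !coefC.
by case: eqP => // _; rewrite (linear0r (act rho)).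
Qed.

Lemma ore_act_one h : ore_act h 1 = counit h *: 1.
Proof.
rewrite [LHS]ore_act_oreC act_one; apply/polyP=> i.
by rewrite coef_ore_scale !coefC; case: eqP; rewrite ?scaler0.
Qed.

Lemma ore_act_oreX h : ore_act h (oreX sigma) = counit h *: oreX sigma.
Proof.
apply/polyP=> i; rewrite coef_ore_scale coef_ore_act coefX.
by case: eqP => _; rewrite ?act_one // (linear0r (act rho)) scaler0.
Qed.

Definition ore_module_algebra : module_algebra H (ore sigma) :=
  ModuleAlgebra ore_act_bilinear ore_act1 ore_actM ore_act_mul ore_act_one.

Lemma ore_module_algebra_ext : extends_to_ore rho ore_module_algebra.
Proof. by split; [exact: ore_act_oreC|exact: ore_act_oreX]. Qed.

Section AnyExtension.
Variable rho' : module_algebra H (ore sigma).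
Hypothesis rho'_ext : extends_to_ore rho rho'.

(** Both actions are trivial on the powers of [t], so [act_mul_invr] determines
    them on each monomial [a t^i] from their common restriction to [A]. *)
Lemma act_extE h p : rho' h p = ore_act h p.
Proof.
have monom (r : module_algebra H (ore sigma)) a i :
    extends_to_ore rho r ->
    r h (oreC sigma a * oreX sigma ^+ i)
      = oreC sigma (rho h a) * oreX sigma ^+ i.
  case=> rC rX; rewrite act_mul_invr ?rC //.
  by apply: invariantsX; apply/invariantsP.
rewrite -[RHS]/(ore_module_algebra h p) [p]oreE !linear_sumr.
apply: eq_bigr => i _.
exact: etrans (monom _ _ _ rho'_ext)
  (esym (monom _ _ _ ore_module_algebra_ext)).
Qed.

Lemma coef_act_ext h p i : (rho' h p)`_i = rho h p`_i.
Proof. by rewrite act_extE coef_ore_act. Qed.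

Lemma ext_invariantsP p :
  p \in invariants rho' <-> forall i, p`_i \in invariants rho.
Proof.
split=> [/invariantsP ip i|ip].
  by apply/invariantsP=> h; rewrite -coef_act_ext ip coef_ore_scale.
apply/invariantsP=> h; apply/polyP=> i.
by rewrite coef_act_ext coef_ore_scale (invariantsP _ _ (ip i)).
Qed.

Lemma ext_invariants :
  [set p | p \in invariants rho'] = range (ore_incl (sigmaH := sigmaH)).
Proof.
apply/seteqP; split=> p /=.
  move=> /ext_invariantsP ip.
  exists (\poly_(i < size p) (InvAlg (ip i))) => //.
  apply/polyP=> i; rewrite coef_ore_incl coef_poly.
  by case: ltnP => //= le_p_i; rewrite nth_default.
case=> q _ <-; apply/ext_invariantsP=> i.
by rewrite coef_ore_incl; exact: inv_valP.
Qed.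

Lemma ext_inner_faithful : inner_faithful rho -> inner_faithful rho'.
Proof.
move=> faith I idealI annI; apply: faith => // h Ih a.
have [extC _] := rho'_ext.
by apply: (@polyC_inj A); rewrite -[LHS]extC annI.
Qed.

End AnyExtension.

End OreExtension.

Theorem proposition7p1 (R : realType) (H : hopfAlgType R[i]) (A : algType R[i])
    (rho : module_algebra H A) (sigma : {lrmorphism A -> A})
    (sigma_bij : bijective sigma)
    (sigmaH : forall h a, sigma (rho h a) = rho h (sigma a)) :
  (exists rho' : module_algebra H (ore sigma), extends_to_ore rho rho') /\
  (forall rho' : module_algebra H (ore sigma), extends_to_ore rho rho' ->
     [set p | p \in invariants rho'] = range (ore_incl (sigmaH := sigmaH)) /\
     (inner_faithful rho -> inner_faithful rho')).
Proof.
split; first by exists (ore_module_algebra sigmaH); exact: ore_module_algebra_ext.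
move=> rho' rho'_ext; split; first exact: ext_invariants.
exact: ext_inner_faithful.
Qed.
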